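(* For every nonzero real number $x$, $$\left.\frac{\partial W_{\alpha,\beta}(x)}{\partial\alpha}\right|_{\alpha=1,\ \beta=0}=-x\left[K_0(2\sqrt x)+\frac12 I_0(2\sqrt x)\ln x\right].$$
   Context: The Wright function is $W_{\alpha,\beta}(x)=\sum_{k=0}^\infty\frac{x^k}{k!\,\Gamma(\alpha k+\beta)}$ (with $1/\Gamma=0$ at the poles of $\Gamma$), so that $\frac{\partial W_{\alpha,\beta}(x)}{\partial\alpha}=-\sum_{k=1}^\infty\frac{\psi(\alpha k+\beta)}{k!\,\Gamma(\alpha k+\beta)}\,k\,x^k$, with $\psi=\Gamma'/\Gamma$ the digamma function. $I_\nu$ and $K_\nu$ are the modified Bessel functions of the first and second kind. For $x<0$, $\ln x$ and $\sqrt x$ denote principal branches. *)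

(* Defs.v *)
From Stdlib Require Import Reals ZArith ClassicalEpsilon.
From Coquelicot Require Import Coquelicot.
Open Scope R_scope.

(** * The Gamma function on the real line *)

(* Euler's integral of the second kind; it converges for [0 < x]. *)
Definition Euler_integral (x : R) : R :=
  RInt_gen (fun t => Rpower t (x - 1) * exp (- t))
           (at_right 0) (Rbar_locally p_infty).

(* [x * (x + 1) * ... * (x + n - 1)] *)
Fixpoint rising (x : R) (n : nat) : R :=
  match n with
  | O => 1
  | S m => rising x m * (x + INR m)
  end.

(* The least [n] with [0 < x + n]; it is [0] when [0 < x]. *)
Definition Gamma_shift (x : R) : nat := Z.to_nat (up (- x)).

(* For [x <= 0] this is the continuation given by the functional equation
   [Gamma (x + 1) = x * Gamma x]; the value at a pole is meaningless. *)
Definition Gamma (x : R) : R :=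
  Euler_integral (x + INR (Gamma_shift x)) / rising x (Gamma_shift x).

Definition Gamma_pole (x : R) : Prop := exists m : nat, x = - INR m.

(* [1 / Gamma], with its zeros at the poles of [Gamma]. *)
Definition rGamma (x : R) : R :=
  if excluded_middle_informative (Gamma_pole x) then 0 else / Gamma x.

(** * The Wright function *)

Definition Wright (alpha beta x : R) : R :=
  Series (fun k : nat =>
    x ^ k / INR (fact k) * rGamma (alpha * INR k + beta)).

(** * Principal branches of elementary complex functions *)

Definition Cexp (z : C) : C :=
  (exp (Re z) * cos (Im z), exp (Re z) * sin (Im z)).

(* For [z <> 0], the argument of [z] in [(-PI, PI]]. *)
Definition Carg (z : C) : R :=
  if Rle_dec 0 (Im z) then acos (Re z / Cmod z) else - acos (Re z / Cmod z).

Definition Clog (z : C) : C := (ln (Cmod z), Carg z).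

Definition Csqrt (z : C) : C :=
  if Ceq_dec z 0 then RtoC 0 else Cexp (Clog z / 2)%C.

(* [z ^ nu], for [z <> 0]. *)
Definition Cpower (z : C) (nu : R) : C := Cexp (nu * Clog z)%C.

(** * Modified Bessel functions of real order *)

(* Sums and limits in [C] are taken componentwise. *)
Definition CSeries (a : nat -> C) : C :=
  (Series (fun k => Re (a k)), Series (fun k => Im (a k))).

Definition CLim (f : R -> C) (t0 : R) : C :=
  (real (Lim (fun t => Re (f t)) t0), real (Lim (fun t => Im (f t)) t0)).

Definition BesselI (nu : R) (z : C) : C :=
  (Cpower (z / 2) nu *
   CSeries (fun k : nat =>
     (z / 2) ^ (2 * k) / INR (fact k) * rGamma (nu + INR k + 1)))%C.

Definition BesselK_quotient (nu : R) (z : C) : C :=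
  (RtoC (PI / 2) * (BesselI (- nu) z - BesselI nu z)
     / RtoC (sin (nu * PI)))%C.

(* The quotient is singular exactly at integer orders, where its limit with
   respect to the order is taken. *)
Definition BesselK (nu : R) (z : C) : C :=
  if Req_EM_T (sin (nu * PI)) 0
  then CLim (fun mu => BesselK_quotient mu z) nu
  else BesselK_quotient nu z.

(* Main.v *)
Require Import Defs.
From Stdlib Require Import Reals Lra Lia Factorial ClassicalEpsilon.
From Coquelicot Require Import Coquelicot.
Open Scope R_scope.

(** Write [g = 1 / Gamma] and
[[
  D = sum_k x^k / k! * g'(k + 1).
]]
    Both sides of the identity equal [x * D].

    On the left, the term [k = 0] of the Wright series vanishes since [0] is a
    pole of [Gamma], and after the shift [k -> k + 1] the series is
    [x * sum_k x^k / k! * g((k + 1) alpha) / (k + 1)]; differentiating term by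
    term at [alpha = 1] cancels the factor [k + 1] and leaves [x * D]
    ([is_derive_Wright]).

    On the right, put [L = Log x / 2]. Principal branches give
    [Log (sqrt x) = L] for negative [x] too, hence
    [I_nu (2 sqrt x) = exp (nu L) * S(nu)] with the real series
    [S(nu) = sum_k x^k / k! * g(nu + k + 1)] ([BesselI_real]). The limit which
    defines [K_0] is minus the derivative of this product at [nu = 0], that is
    [K_0 (2 sqrt x) = - (L * S(0) + S'(0))] ([BesselK_0_real]). Since
    [I_0 (2 sqrt x) = S(0)], adding [I_0 * Log x / 2] cancels the logarithm, and
    what remains is [- S'(0) = - D] ([is_derive_Bessel_sum]).

    The two differentiations under the sum are instances of one lemma,
    [is_derive_stretched_series]. It only needs that [g] is differentiable on
    the positive axis and Lipschitz on [[1/2, T]] with a constant linear in [T],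
    because [1 / k!] beats any power of [k + 1]. Both facts come, as in the
    Bohr-Mollerup theorem, from the functional equation of Euler's integral and
    from its logarithmic convexity, so that [Gamma] is never differentiated
    under the integral sign. The functional equation traps the slopes of the
    convex function [ln Gamma] between values of [ln], which gives the Lipschitz
    bound; and two slopes at [s + n] differ by at most [O(1/n)], while passing
    from [s + n] to [s] changes [ln Gamma] only by smooth functions, which gives
    differentiability. *)

(** * Euler's integral: convergence, functional equation, convexity *)

Lemma ball_Rabs (x y : R) (e : posreal) : ball x e y = (Rabs (y - x) < e).
Proof. reflexivity. Qed.

Lemma exp_nondecreasing (a b : R) : a <= b -> exp a <= exp b.
Proof. intros [H | ->]; [left; now apply exp_increasing | apply Rle_refl]. Qed.

Lemma filter_prod_at_right_0_p_infty (P : R * R -> Prop) (a b : R) :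
  0 < a -> (forall u v, 0 < u < a -> b < v -> P (u, v)) ->
  filter_prod (at_right 0) (Rbar_locally p_infty) P.
Proof.
intros Ha H.
apply Filter_prod with (Q := fun u => 0 < u < a) (R := fun v => b < v).
- exists (mkposreal a Ha); intros u Hu Hu0.
  rewrite ball_Rabs in Hu; simpl in Hu.
  rewrite Rabs_right in Hu; lra.
- exists b; tauto.
- exact H.
Qed.

Lemma ex_RInt_continuous_pos (f : R -> R) (a b : R) :
  (forall t, 0 < t -> continuous f t) -> 0 < a -> 0 < b -> ex_RInt f a b.
Proof.
intros Hc Ha Hb; apply (@ex_RInt_continuous R_CompleteNormedModule).
intros z Hz; apply Hc; revert Hz; unfold Rmin; destruct (Rle_dec a b); lra.
Qed.

(** Partial integrals of a nonnegative function grow with the interval, so the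
    improper integral is their supremum; the second half of the conclusion is
    what yields strict positivity of Euler's integral. *)
Lemma is_RInt_gen_bounded (f : R -> R) (M : R) :
  (forall t, 0 < t -> continuous f t) -> (forall t, 0 < t -> 0 <= f t) ->
  (forall a b, 0 < a < b -> RInt f a b <= M) ->
  exists l, is_RInt_gen f (at_right 0) (Rbar_locally p_infty) l /\
    forall a b, 0 < a < b -> RInt f a b <= l.
Proof.
intros Hc H0 HM.
assert (Hex : forall a b, 0 < a -> 0 < b -> ex_RInt f a b)
  by (intros; now apply ex_RInt_continuous_pos).
destruct (completeness (fun y => exists a b, 0 < a < b /\ y = RInt f a b))
  as [l [Hub Hlub]].
- exists M; intros y (a & b & Hab & ->); now apply HM.
- exists (RInt f 1 2), 1, 2; split; [lra | reflexivity].
- exists l; split; [ | intros a b Hab; apply Hub; now exists a, b].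
  assert (Hinc : forall a b u v, 0 < u < a -> a < b < v -> RInt f a b <= RInt f u v).
  { intros a b u v Hu Hv.
    assert (E1 := RInt_Chasles f u a b (Hex u a ltac:(lra) ltac:(lra)) (Hex a b ltac:(lra) ltac:(lra))).
    assert (E2 := RInt_Chasles f u b v (Hex u b ltac:(lra) ltac:(lra)) (Hex b v ltac:(lra) ltac:(lra))).
    assert (P1 : 0 <= RInt f u a) by (apply RInt_ge_0; [lra | apply Hex; lra | intros; apply H0; lra]).
    assert (P2 : 0 <= RInt f b v) by (apply RInt_ge_0; [lra | apply Hex; lra | intros; apply H0; lra]).
    unfold plus in E1, E2; simpl in E1, E2; lra. }
  intros P [eps HP].
  assert (Hn : ~ is_upper_bound (fun y => exists a b, 0 < a < b /\ y = RInt f a b) (l - eps)).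
  { intros Hb; apply Hlub in Hb; destruct eps as [e He]; simpl in *; lra. }
  assert (Ha : exists a b, 0 < a < b /\ l - eps < RInt f a b).
  { apply NNPP; intros HN; apply Hn; intros y (a & b & Hab & ->).
    apply Rnot_lt_le; intros Hlt; apply HN; now exists a, b. }
  destruct Ha as (a & b & Hab & Hl).
  apply (filter_prod_at_right_0_p_infty _ a b); [lra | ].
  intros u v Hu Hv; simpl; exists (RInt f u v); split.
  + apply (@RInt_correct R_CompleteNormedModule), Hex; lra.
  + apply HP.
    assert (RInt f a b <= RInt f u v) by (apply Hinc; lra).
    assert (RInt f u v <= l) by (apply Hub; exists u, v; split; [lra | reflexivity]).
    rewrite ball_Rabs.
    apply Rabs_def1; destruct eps; simpl in *; lra.
Qed.

Definition Euler_integrand (s t : R) : R := Rpower t (s - 1) * exp (- t).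

Lemma continuous_Euler_integrand (s t : R) : 0 < t -> continuous (Euler_integrand s) t.
Proof.
intros Ht; apply (@ex_derive_continuous R_AbsRing R_NormedModule).
unfold Euler_integrand, Rpower; auto_derive; exact Ht.
Qed.

Lemma Euler_integrand_pos (s t : R) : 0 < Euler_integrand s t.
Proof. apply Rmult_lt_0_compat; apply exp_pos. Qed.

Lemma is_derive_Euler_integrand_succ (s t : R) : 0 < t ->
  is_derive (Euler_integrand (s + 1)) t
    (s * Euler_integrand s t - Euler_integrand (s + 1) t).
Proof.
intros Ht; unfold Euler_integrand; replace (s + 1 - 1) with s by ring.
replace (Rpower t (s - 1)) with (Rpower t s / t).
- unfold Rpower; auto_derive; [exact Ht | field; lra].
- unfold Rminus; rewrite Rpower_plus, Rpower_Ropp, Rpower_1 by exact Ht; reflexivity.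
Qed.

(** From [ln u <= u - 1] at [u = t / (2 s)], which spends exactly half of the
    exponential decay. *)
Lemma Euler_integrand_succ_le (s t : R) : 0 < s -> 0 < t ->
  Euler_integrand (s + 1) t <= exp (s * ln (2 * s)) * exp (- (t / 2)).
Proof.
intros Hs Ht; unfold Euler_integrand, Rpower; rewrite <- !exp_plus.
assert (Hl : ln t <= t / (2 * s) - 1 + ln (2 * s)).
{ assert (H : 0 < t / (2 * s)) by (apply Rdiv_lt_0_compat; lra).
  assert (E : ln t = ln (t / (2 * s)) + ln (2 * s)).
  { rewrite <- ln_mult by lra; f_equal; field; lra. }
  assert (B := exp_ineq1_le (ln (t / (2 * s)))); rewrite exp_ln in B by exact H; lra. }
apply (Rmult_le_compat_l s) in Hl; [ | lra].
replace (s * (t / (2 * s) - 1 + ln (2 * s))) with (t / 2 - s + s * ln (2 * s)) in Hl by (field; lra).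
apply exp_nondecreasing; replace (s + 1 - 1) with s by ring; lra.
Qed.

(** Integrating the derivative of [t^s exp (- t)] bounds [s * int t^(s-1) exp (- t)]
    by boundary terms plus [int t^s exp (- t)], and the latter has no singularity
    at [0]; so one majorant serves both ends of the interval. *)
Lemma is_Euler_integral (s : R) : 0 < s ->
  is_RInt_gen (Euler_integrand s) (at_right 0) (Rbar_locally p_infty) (Euler_integral s)
  /\ 0 < Euler_integral s.
Proof.
intros Hs; set (C := exp (s * ln (2 * s))).
assert (HC : 0 < C) by apply exp_pos.
destruct (is_RInt_gen_bounded (Euler_integrand s) (3 * C / s)) as [l [Hl Hle]].
- apply continuous_Euler_integrand.
- intros t _; left; apply Euler_integrand_pos.
- intros a b Hab.
  apply (Rmult_le_reg_l s); [exact Hs | ].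
  replace (s * (3 * C / s)) with (3 * C) by (field; lra).
  (* an antiderivative of a majorant of [s * Euler_integrand s] *)
  set (F := fun t => Euler_integrand (s + 1) t - 2 * C * exp (- (t / 2))).
  set (dF := fun t => s * Euler_integrand s t - Euler_integrand (s + 1) t + C * exp (- (t / 2))).
  assert (HF : is_RInt dF a b (F b - F a)).
  { apply (@is_RInt_derive R_CompleteNormedModule); intros t Ht; rewrite Rmin_left in Ht by lra.
    - unfold F, dF.
      apply (is_derive_ext (fun t => minus (Euler_integrand (s + 1) t) (2 * C * exp (- (t / 2)))));
        [reflexivity | ].
      replace (s * Euler_integrand s t - Euler_integrand (s + 1) t + C * exp (- (t / 2)))
        with (minus (s * Euler_integrand s t - Euler_integrand (s + 1) t) (- C * exp (- (t / 2))))
        by (unfold minus, plus, opp; simpl; ring).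
      apply @is_derive_minus; [apply is_derive_Euler_integrand_succ; lra | ].
      auto_derive; [exact I | unfold Rdiv; field].
    - unfold dF; repeat apply @continuous_plus.
      + apply @continuous_mult; [apply continuous_const | apply continuous_Euler_integrand; lra].
      + apply @continuous_opp, continuous_Euler_integrand; lra.
      + apply (@ex_derive_continuous R_AbsRing R_NormedModule); auto_derive; exact I. }
  assert (Hi : is_RInt (fun t => s * Euler_integrand s t) a b (s * RInt (Euler_integrand s) a b)).
  { apply (is_RInt_scal (Euler_integrand s) a b s), (@RInt_correct R_CompleteNormedModule).
    apply ex_RInt_continuous_pos; [apply continuous_Euler_integrand | lra | lra]. }
  assert (H1 : s * RInt (Euler_integrand s) a b <= F b - F a).
  { apply (is_RInt_le (fun t => s * Euler_integrand s t) dF a b); [lra | exact Hi | exact HF | ].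
    intros t Ht; unfold dF; assert (H := Euler_integrand_succ_le s t Hs ltac:(lra)); fold C in H; lra. }
  assert (H2 := Euler_integrand_succ_le s b Hs ltac:(lra)); fold C in H2.
  assert (H3 := Euler_integrand_pos (s + 1) a).
  assert (He : forall t, 0 < t -> 0 < exp (- (t / 2)) < 1).
  { intros t Ht; split; [apply exp_pos | rewrite <- exp_0; apply exp_increasing; lra]. }
  assert (H4 := He a ltac:(lra)); assert (H5 := He b ltac:(lra)).
  unfold F in H1; nra.
- replace (Euler_integral s) with l.
  + split; [exact Hl | ].
    apply Rlt_le_trans with (RInt (Euler_integrand s) 1 2); [ | apply Hle; lra].
    apply RInt_gt_0; [lra | intros; apply Euler_integrand_pos | ].
    intros t Ht; apply continuous_Euler_integrand; lra.
  + symmetry; unfold Euler_integral.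
    apply (@is_RInt_gen_unique R_CompleteNormedModule); [ | | exact Hl];
      apply Proper_StrongProper; typeclasses eauto.
Qed.

(** Integration by parts: [t^s exp (- t)] tends to [0] at both ends. *)
Lemma Euler_integral_succ (s : R) : 0 < s ->
  Euler_integral (s + 1) = s * Euler_integral s.
Proof.
intros Hs.
destruct (is_Euler_integral s Hs) as [H0 _].
destruct (is_Euler_integral (s + 1) ltac:(lra)) as [H1 _].
set (dF := fun t => s * Euler_integrand s t - Euler_integrand (s + 1) t).
assert (HD : forall t, 0 < t -> Derive (Euler_integrand (s + 1)) t = dF t).
{ intros t Ht; apply is_derive_unique, is_derive_Euler_integrand_succ, Ht. }
set (C := exp (s * ln (2 * s))).
assert (HC : 0 < C) by apply exp_pos.
assert (Hl0 : filterlim (Euler_integrand (s + 1)) (at_right 0) (locally 0)).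
{ intros P [eps HP].
  assert (Hd : 0 < Rpower eps (/ s)) by apply exp_pos.
  exists (mkposreal _ Hd); intros t Ht Ht0; apply HP.
  rewrite ball_Rabs in Ht; simpl in Ht.
  rewrite Rminus_0_r, Rabs_right in Ht by lra.
  rewrite ball_Rabs.
  assert (Hp := Euler_integrand_pos (s + 1) t).
  rewrite Rminus_0_r, Rabs_right by lra.
  unfold Euler_integrand; replace (s + 1 - 1) with s by ring.
  assert (exp (- t) < 1) by (rewrite <- exp_0; apply exp_increasing; lra).
  assert (0 < exp (- t)) by apply exp_pos.
  assert (0 < Rpower t s) by apply exp_pos.
  assert (Hlt : Rpower t s < Rpower (Rpower eps (/ s)) s) by (apply Rlt_Rpower_l; lra).
  rewrite Rpower_mult, Rinv_l, Rpower_1 in Hlt; [nra | apply cond_pos | lra]. }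
assert (Hl1 : filterlim (Euler_integrand (s + 1)) (Rbar_locally p_infty) (locally 0)).
{ intros P [eps HP].
  exists (Rmax 0 (2 * ln (C / eps))); intros t Ht; apply HP.
  assert (Ht0 : 0 < t) by (eapply Rle_lt_trans; [apply Rmax_l | exact Ht]).
  assert (Ht1 : 2 * ln (C / eps) < t) by (eapply Rle_lt_trans; [apply Rmax_r | exact Ht]).
  rewrite ball_Rabs.
  assert (Hp := Euler_integrand_pos (s + 1) t).
  rewrite Rminus_0_r, Rabs_right by lra.
  eapply Rle_lt_trans; [apply Euler_integrand_succ_le; lra | ]; fold C.
  assert (He := cond_pos eps).
  assert (Hlt : exp (- (t / 2)) < exp (- ln (C / eps))) by (apply exp_increasing; lra).
  rewrite (exp_Ropp (ln _)), exp_ln in Hlt by (apply Rdiv_lt_0_compat; lra).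
  apply (Rmult_lt_compat_l C) in Hlt; [ | exact HC].
  replace (C * / (C / eps)) with (pos eps) in Hlt by (field; lra); exact Hlt. }
assert (HI : is_RInt_gen (Derive (Euler_integrand (s + 1))) (at_right 0) (Rbar_locally p_infty) (0 - 0)).
{ apply is_RInt_gen_Derive; [ | | exact Hl0 | exact Hl1];
    apply (filter_prod_at_right_0_p_infty _ 1 1); try lra; intros u v Hu Hv t Ht;
    simpl in Ht; rewrite Rmin_left in Ht by lra.
  - eexists; apply is_derive_Euler_integrand_succ; lra.
  - apply (continuous_ext_loc _ dF).
    + assert (Ht0 : 0 < t) by lra.
      exists (mkposreal t Ht0); intros y Hy; symmetry; apply HD.
      rewrite ball_Rabs in Hy; simpl in Hy.
      apply Rabs_def2 in Hy; lra.
    + unfold dF; apply @continuous_minus;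
        [apply @continuous_mult; [apply continuous_const | ] | ]; apply continuous_Euler_integrand; lra. }
assert (HJ := is_RInt_gen_minus _ _ _ _ (is_RInt_gen_scal _ s _ H0) H1).
apply (is_RInt_gen_ext (Fa := at_right 0) (Fb := Rbar_locally p_infty) _
  (Derive (Euler_integrand (s + 1)))) in HJ.
- assert (HU : forall l, is_RInt_gen (Derive (Euler_integrand (s + 1)))
      (at_right 0) (Rbar_locally p_infty) l ->
      RInt_gen (Derive (Euler_integrand (s + 1))) (at_right 0) (Rbar_locally p_infty) = l).
  { intros l Hl; apply (@is_RInt_gen_unique R_CompleteNormedModule); [ | | exact Hl];
      apply Proper_StrongProper; typeclasses eauto. }
  assert (E1 := HU _ HJ); rewrite (HU _ HI) in E1.
  unfold minus, plus, opp, scal in E1; simpl in E1; unfold mult in E1; simpl in E1; lra.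
- apply (filter_prod_at_right_0_p_infty _ 1 1); [lra | ].
  intros u v Hu Hv t Ht; simpl in Ht; rewrite Rmin_left in Ht by lra.
  rewrite HD by lra; reflexivity.
Qed.

(** Hoelder's inequality. After dividing the integrands at [a] and [c] by their
    integrals it reduces to the pointwise convexity of [exp], and hence to
    integrating [exp (th X + (1 - th) Y) <= th exp X + (1 - th) exp Y]. *)
Lemma ln_Euler_integral_convex (a c th : R) : 0 < a -> 0 < c -> 0 <= th <= 1 ->
  ln (Euler_integral (th * a + (1 - th) * c)) <=
    th * ln (Euler_integral a) + (1 - th) * ln (Euler_integral c).
Proof.
intros Ha Hc Hth; set (b := th * a + (1 - th) * c).
assert (Hb : 0 < b).
{ unfold b; destruct (Rle_lt_dec th (1 / 2)); nra. }
destruct (is_Euler_integral a Ha) as [Ia Pa].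
destruct (is_Euler_integral b Hb) as [Ib Pb].
destruct (is_Euler_integral c Hc) as [Ic Pc].
set (m := th * ln (Euler_integral a) + (1 - th) * ln (Euler_integral c)).
assert (H : norm (scal (exp (- m)) (Euler_integral b)) <=
  plus (scal (th * exp (- ln (Euler_integral a))) (Euler_integral a))
       (scal ((1 - th) * exp (- ln (Euler_integral c))) (Euler_integral c))).
{ assert (Hl := is_RInt_gen_scal _ (exp (- m)) _ Ib).
  assert (Hr := is_RInt_gen_plus _ _ _ _
    (is_RInt_gen_scal _ (th * exp (- ln (Euler_integral a))) _ Ia)
    (is_RInt_gen_scal _ ((1 - th) * exp (- ln (Euler_integral c))) _ Ic)).
  refine (RInt_gen_norm (V := R_CompleteNormedModule) _ _ _ _ _ _ Hl Hr).
  - apply (filter_prod_at_right_0_p_infty _ 1 1); [lra | intros; simpl; lra].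
  - apply (filter_prod_at_right_0_p_infty _ 1 1); [lra | intros u v Hu Hv t Ht; simpl in Ht].
    unfold norm, plus, scal; simpl; unfold abs, mult; simpl.
    assert (P0 := Euler_integrand_pos b t).
    assert (P1 := exp_pos (- m)).
    rewrite Rabs_right by nra.
    unfold Euler_integrand, Rpower.
    set (X := - ln (Euler_integral a) + (a - 1) * ln t).
    set (Y := - ln (Euler_integral c) + (c - 1) * ln t).
    assert (E0 : exp (- m) * (exp ((b - 1) * ln t) * exp (- t)) =
                 exp (th * X + (1 - th) * Y) * exp (- t)).
    { rewrite <- Rmult_assoc, <- exp_plus; do 2 f_equal; unfold X, Y, m, b; ring. }
    assert (EX : exp X = exp (- ln (Euler_integral a)) * exp ((a - 1) * ln t)) by apply exp_plus.
    assert (EY : exp Y = exp (- ln (Euler_integral c)) * exp ((c - 1) * ln t)) by apply exp_plus.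
    (* the tangent of [exp] at the convex combination lies below [exp] *)
    assert (T : forall u, exp (th * X + (1 - th) * Y) * (1 + (u - (th * X + (1 - th) * Y))) <= exp u).
    { intros w; replace (exp w) with (exp (th * X + (1 - th) * Y) * exp (w - (th * X + (1 - th) * Y))).
      - apply Rmult_le_compat_l; [left; apply exp_pos | apply exp_ineq1_le].
      - rewrite <- exp_plus; f_equal; ring. }
    assert (TX := T X); assert (TY := T Y); clear T.
    apply (Rmult_le_compat_l th) in TX; [ | lra].
    apply (Rmult_le_compat_l (1 - th)) in TY; [ | lra].
    assert (exp (th * X + (1 - th) * Y) <= th * exp X + (1 - th) * exp Y) by lra.
    rewrite E0.
    apply Rle_trans with ((th * exp X + (1 - th) * exp Y) * exp (- t)).
    + apply Rmult_le_compat_r; [left; apply exp_pos | assumption].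
    + rewrite EX, EY; right; ring. }
unfold norm, plus, scal in H; simpl in H; unfold abs, mult in H; simpl in H.
assert (P1 := exp_pos (- m)).
rewrite Rabs_right in H by nra.
rewrite !exp_Ropp, !exp_ln in H by assumption.
replace (th * / Euler_integral a * Euler_integral a + (1 - th) * / Euler_integral c * Euler_integral c)
  with 1 in H by (field; lra).
assert (Pm := exp_pos m).
apply (Rmult_le_compat_l (exp m)) in H; [ | lra].
rewrite <- Rmult_assoc, Rinv_r, Rmult_1_l, Rmult_1_r in H by lra.
rewrite <- (ln_exp m); apply ln_le; assumption.
Qed.

(** * Slopes of the logarithm of Gamma *)

Definition lnGamma (s : R) : R := ln (Euler_integral s).

Lemma lnGamma_succ (s : R) : 0 < s -> lnGamma (s + 1) = lnGamma s + ln s.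
Proof.
intros Hs; unfold lnGamma; rewrite Euler_integral_succ by exact Hs.
rewrite ln_mult; [ring | exact Hs | apply is_Euler_integral, Hs].
Qed.

Definition slope (f : R -> R) (a b : R) : R := (f b - f a) / (b - a).

Lemma slope_lnGamma_le (a b c : R) : 0 < a -> a < b -> b < c ->
  slope lnGamma a b <= slope lnGamma b c.
Proof.
intros Ha Hab Hbc.
assert (Hth : 0 <= (c - b) / (c - a) <= 1).
{ split; [apply Rle_div_r | apply Rle_div_l]; lra. }
assert (H := ln_Euler_integral_convex a c ((c - b) / (c - a)) Ha ltac:(lra) Hth).
replace ((c - b) / (c - a) * a + (1 - (c - b) / (c - a)) * c) with b in H by (field; lra).
fold (lnGamma a) (lnGamma b) (lnGamma c) in H.
replace ((c - b) / (c - a) * lnGamma a + (1 - (c - b) / (c - a)) * lnGamma c)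
  with (((c - b) * lnGamma a + (b - a) * lnGamma c) / (c - a)) in H by (field; lra).
apply Rle_div_r in H; [ | lra].
unfold slope; apply Rle_div_l; [lra | ].
replace ((lnGamma c - lnGamma b) / (c - b) * (b - a))
  with ((lnGamma c - lnGamma b) * (b - a) / (c - b)) by (field; lra).
apply Rle_div_r; nra.
Qed.

Lemma slope_lnGamma_succ (s : R) : 0 < s -> slope lnGamma s (s + 1) = ln s.
Proof. intros Hs; unfold slope; rewrite lnGamma_succ by exact Hs; field; lra. Qed.

(** The chord over [[v, v + 1]] has slope [ln v] by the functional equation, and
    slopes of a convex function increase. *)
Lemma slope_lnGamma_le_ln (u v : R) : 0 < u -> u < v -> slope lnGamma u v <= ln v.
Proof.
intros Hu Huv; rewrite <- (slope_lnGamma_succ v) by lra; apply slope_lnGamma_le; lra.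
Qed.

Lemma ln_le_slope_lnGamma (u v : R) : 1 < u -> u < v -> ln (u - 1) <= slope lnGamma u v.
Proof.
intros Hu Huv; rewrite <- (slope_lnGamma_succ (u - 1)) by lra.
replace (u - 1 + 1) with u by ring; apply slope_lnGamma_le; lra.
Qed.

Lemma slope_sym (f : R -> R) (a b : R) : a <> b -> slope f a b = slope f b a.
Proof. intros H; unfold slope; field; lra. Qed.

(** The Cauchy criterion, at tolerance [e], for the limit of the slopes of [f]
    at [s]. *)
Definition slopes_within (f : R -> R) (s e : R) : Prop :=
  exists d, 0 < d /\ forall u v, u <> s -> v <> s ->
    Rabs (u - s) < d -> Rabs (v - s) < d -> Rabs (slope f s u - slope f s v) <= e.

Lemma ln_sub_le (a b : R) : 0 < a -> a <= b -> ln b - ln a <= (b - a) / a.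
Proof.
intros Ha Hab.
assert (H := exp_ineq1_le (ln (b / a))).
rewrite exp_ln, ln_div in H by (try apply Rdiv_lt_0_compat; lra).
replace ((b - a) / a) with (b / a - 1) by (field; lra); lra.
Qed.

(** All slopes at [s] over distances below [1] lie between [ln (s - 2)] and
    [ln (s + 1)]. *)
Lemma slopes_within_lnGamma_large (s : R) : 2 < s ->
  slopes_within lnGamma s (3 / (s - 2)).
Proof.
intros Hs; exists 1; split; [lra | ].
assert (Hb : forall u, u <> s -> Rabs (u - s) < 1 ->
  ln (s - 2) <= slope lnGamma s u <= ln (s + 1)).
{ intros u Hu Hd; apply Rabs_def2 in Hd.
  destruct (Rle_lt_dec u s) as [H | H]; [rewrite slope_sym by lra | ]; split.
  - apply Rle_trans with (ln (u - 1)); [apply ln_le; lra | apply ln_le_slope_lnGamma; lra].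
  - apply Rle_trans with (ln s); [apply slope_lnGamma_le_ln; lra | apply ln_le; lra].
  - apply Rle_trans with (ln (s - 1)); [apply ln_le; lra | apply ln_le_slope_lnGamma; lra].
  - apply Rle_trans with (ln u); [apply slope_lnGamma_le_ln; lra | apply ln_le; lra]. }
intros u v Hu Hv Hdu Hdv.
assert (H1 := Hb u Hu Hdu); assert (H2 := Hb v Hv Hdv).
assert (H3 := ln_sub_le (s - 2) (s + 1) ltac:(lra) ltac:(lra)).
replace (s + 1 - (s - 2)) with 3 in H3 by ring.
apply Rabs_le; lra.
Qed.

Lemma slopes_within_derivable (f : R -> R) (s l e : R) :
  is_derive f s l -> 0 < e -> slopes_within f s e.
Proof.
intros Hf He; apply is_derive_Reals in Hf.
destruct (Hf (e / 2) ltac:(lra)) as [d Hd].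
exists d; split; [apply cond_pos | ].
intros u v Hu Hv Hdu Hdv.
assert (H1 := Hd (u - s) ltac:(lra) Hdu); assert (H2 := Hd (v - s) ltac:(lra) Hdv).
replace (s + (u - s)) with u in H1 by ring; replace (s + (v - s)) with v in H2 by ring.
apply Rabs_def2 in H1; apply Rabs_def2 in H2; unfold slope; apply Rabs_le; lra.
Qed.

(** [lnGamma t = lnGamma (t + 1) - ln t], and [ln] is differentiable, so the
    tolerance is inherited up to an arbitrarily small loss. *)
Lemma slopes_within_lnGamma_pred (s e e' : R) : 0 < s -> e < e' ->
  slopes_within lnGamma (s + 1) e -> slopes_within lnGamma s e'.
Proof.
intros Hs He [d [Hd H]].
destruct (slopes_within_derivable ln s (/ s) (e' - e)) as [d' [Hd' H']].
{ apply is_derive_Reals, derivable_pt_lim_ln, Hs. } { lra. }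
assert (E : forall u, 0 < u -> u <> s ->
  slope lnGamma s u = slope lnGamma (s + 1) (u + 1) - slope ln s u).
{ intros u Hu Hus; unfold slope; rewrite !lnGamma_succ by lra; field; lra. }
exists (Rmin (Rmin d d') s); split; [repeat apply Rmin_pos; assumption | ].
assert (Hm : forall x, Rabs (x - s) < Rmin (Rmin d d') s ->
  Rabs (x - s) < d /\ Rabs (x - s) < d' /\ 0 < x).
{ intros x Hx.
  assert (A := Rmin_l (Rmin d d') s); assert (B := Rmin_r (Rmin d d') s).
  assert (C := Rmin_l d d'); assert (D := Rmin_r d d').
  repeat split; try lra.
  assert (Hx' : Rabs (x - s) < s) by lra; apply Rabs_def2 in Hx'; lra. }
intros u v Hu Hv Hdu Hdv.
destruct (Hm u Hdu) as (U1 & U2 & U3); destruct (Hm v Hdv) as (V1 & V2 & V3).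
rewrite !E by assumption.
assert (A := H (u + 1) (v + 1) ltac:(lra) ltac:(lra)).
replace (u + 1 - (s + 1)) with (u - s) in A by ring.
replace (v + 1 - (s + 1)) with (v - s) in A by ring.
specialize (A U1 V1); assert (B := H' u v Hu Hv U2 V2).
apply Rabs_le_between in A; apply Rabs_le_between in B; apply Rabs_le; lra.
Qed.

(** The tolerance available at [s + n] tends to [0] as [n] grows, and it can be
    carried back to [s] in [n] steps. *)
Lemma slopes_within_lnGamma (s e : R) : 0 < s -> 0 < e -> slopes_within lnGamma s e.
Proof.
intros Hs He.
assert (Hn : forall n s e e', 0 < s -> e < e' ->
  slopes_within lnGamma (s + INR n) e -> slopes_within lnGamma s e').
{ induction n as [ | n IH]; intros s0 e0 e' Hs0 He0 H.
  - rewrite Rplus_0_r in H; destruct H as [d [Hd H]]; exists d; split; [exact Hd | ].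
    intros u v; intros; apply Rle_trans with e0; [now apply H | lra].
  - apply slopes_within_lnGamma_pred with ((e0 + e') / 2); [exact Hs0 | lra | ].
    apply IH with e0; [lra | lra | ].
    rewrite S_INR in H; replace (s0 + 1 + INR n) with (s0 + (INR n + 1)) by ring; exact H. }
destruct (nfloor_ex (2 + 6 / e)) as [n Hnf].
{ assert (0 < 6 / e) by (apply Rdiv_lt_0_compat; lra); lra. }
apply (Hn (S n) s (e / 2) e Hs ltac:(lra)).
assert (Hs2 : 6 / e < s + INR (S n) - 2) by (rewrite S_INR; lra).
assert (H6 : 0 < 6 / e) by (apply Rdiv_lt_0_compat; lra).
destruct (slopes_within_lnGamma_large (s + INR (S n)) ltac:(lra)) as [d [Hd H]].
exists d; split; [exact Hd | ].
intros u v; intros; apply Rle_trans with (3 / (s + INR (S n) - 2)); [now apply H | ].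
apply Rle_div_l; [lra | ].
apply Rle_trans with (e / 2 * (6 / e)); [right; field; lra | ].
apply Rmult_le_compat_l; lra.
Qed.

Lemma ex_derive_slopes_within (f : R -> R) (s : R) :
  (forall e, 0 < e -> slopes_within f s e) -> ex_derive f s.
Proof.
intros H.
destruct (proj1 (filterlim_locally_cauchy (U := R_CompleteSpace) (F := Rbar_locally' s) (slope f s)))
  as [l Hl].
- intros eps; destruct (H (eps / 2)) as [d [Hd Hs]]; [destruct eps; simpl; lra | ].
  exists (fun u => u <> s /\ Rabs (u - s) < d); split.
  + exists (mkposreal d Hd); intros y Hy Hys; now split.
  + intros u v [Hu Hdu] [Hv Hdv].
    change (Rabs (slope f s v - slope f s u) < eps).
    rewrite Rabs_minus_sym.
    eapply Rle_lt_trans; [now apply Hs | destruct eps; simpl; lra].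
- exists l; apply is_derive_Reals; intros e He.
  destruct (Hl (fun y => Rabs (y - l) < e)) as [d Hd].
  { exists (mkposreal e He); intros y Hy; exact Hy. }
  exists d; intros h Hh Hhd.
  assert (A := Hd (s + h)); unfold slope in A.
  replace (s + h - s) with h in A by ring; apply A; [ | lra].
  rewrite ball_Rabs.
  replace (s + h - s) with h by ring; exact Hhd.
Qed.

Lemma ex_derive_inv_Euler_integral (s : R) : 0 < s ->
  ex_derive (fun t => / Euler_integral t) s.
Proof.
intros Hs.
destruct (ex_derive_slopes_within lnGamma s) as [l Hl].
{ intros; now apply slopes_within_lnGamma. }
exists (scal (- l) (exp (- lnGamma s))).
apply (is_derive_ext_loc (fun t => exp (- lnGamma t))).
- exists (mkposreal s Hs); intros y Hy.
  rewrite ball_Rabs in Hy; simpl in Hy.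
  apply Rabs_def2 in Hy; unfold lnGamma.
  rewrite exp_Ropp, exp_ln; [reflexivity | apply is_Euler_integral; lra].
- apply (is_derive_comp exp (fun t => - lnGamma t)).
  + apply is_derive_Reals, derivable_pt_lim_exp.
  + apply (is_derive_opp lnGamma), Hl.
Qed.

(** Slopes of [lnGamma] beyond [1/2] lie between [- M] and [v], where [v] is the
    right end of the chord and [- M] bounds the slope over [[1/4, 1/2]] from
    below; composing with [exp (- .)], which is Lipschitz where [lnGamma] is
    bounded below, transfers this to [1 / Gamma]. *)
Lemma inv_Euler_integral_lipschitz : exists C, 0 <= C /\
  forall T u v, 1 <= T -> 1 / 2 <= u <= T -> 1 / 2 <= v <= T ->
  Rabs (/ Euler_integral u - / Euler_integral v) <= C * T * Rabs (u - v).
Proof.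
set (M := Rabs (slope lnGamma (1 / 4) (1 / 2))).
set (B := lnGamma 2 - ln 2 - ln 3).
assert (HM : 0 <= M) by apply Rabs_pos.
(* [lnGamma] increases from [2] on, as its slope over [[1, 2]] is [ln 1 = 0];
   two steps of the functional equation reach the points below [2]. *)
assert (Hlow : forall y, 1 / 2 <= y -> B <= lnGamma y).
{ assert (H2 : forall y, 2 <= y -> lnGamma 2 <= lnGamma y).
  { intros y [Hy | <-]; [ | apply Rle_refl].
    assert (H := ln_le_slope_lnGamma 2 y ltac:(lra) Hy).
    replace (2 - 1) with 1 in H by ring; rewrite ln_1 in H.
    unfold slope in H; apply Rle_div_r in H; lra. }
  intros y Hy; unfold B.
  assert (L2 : ln 1 <= ln 2) by (apply ln_le; lra).
  assert (L3 : ln 1 <= ln 3) by (apply ln_le; lra).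
  rewrite ln_1 in L2, L3.
  destruct (Rle_lt_dec 2 y) as [H | H]; [assert (A := H2 y H); lra | ].
  assert (A := H2 (y + 1 + 1) ltac:(lra)); rewrite !lnGamma_succ in A by lra.
  assert (ln y <= ln 2) by (apply ln_le; lra).
  assert (ln (y + 1) <= ln 3) by (apply ln_le; lra); lra. }
exists (exp (- B) * (M + 1)); split.
{ apply Rmult_le_pos; [left; apply exp_pos | lra]. }
assert (Hlip : forall u v, 1 / 2 <= u -> u < v ->
  Rabs (lnGamma u - lnGamma v) <= (M + v) * (v - u)).
{ intros u v Hu Huv.
  assert (H1 := slope_lnGamma_le_ln u v ltac:(lra) Huv).
  assert (Hs : - M <= slope lnGamma u v).
  { assert (H0 : - M <= slope lnGamma (1 / 4) (1 / 2)).
    { unfold M; assert (A := Rle_abs (- slope lnGamma (1 / 4) (1 / 2))); rewrite Rabs_Ropp in A; lra. }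
    destruct Hu as [Hu | <-].
    - assert (A := slope_lnGamma_le (1 / 4) (1 / 2) u ltac:(lra) ltac:(lra) Hu).
      assert (A' := slope_lnGamma_le (1 / 2) u v ltac:(lra) Hu Huv); lra.
    - assert (A := slope_lnGamma_le (1 / 4) (1 / 2) v ltac:(lra) ltac:(lra) Huv); lra. }
  assert (Hl : ln v <= v).
  { assert (A := exp_ineq1_le (ln v)); rewrite exp_ln in A by lra; lra. }
  unfold slope in *; apply Rle_div_r in Hs; [ | lra].
  assert (Hs' : lnGamma v - lnGamma u <= ln v * (v - u)) by (apply Rle_div_l; lra).
  apply Rabs_le; nra. }
assert (Hexp : forall p q, B <= p -> B <= q -> 
  Rabs (exp (- p) - exp (- q)) <= exp (- B) * Rabs (p - q)).
{ assert (W : forall p q, B <= p -> p <= q -> Rabs (exp (- p) - exp (- q)) <= exp (- B) * Rabs (p - q)).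
  { intros p q Hp Hpq.
    assert (E1 : exp (- p) <= exp (- B)) by (apply exp_nondecreasing; lra).
    assert (E2 : exp (- q) <= exp (- p)) by (apply exp_nondecreasing; lra).
    assert (E3 : exp (- q) = exp (- p) * exp (p - q)) by (rewrite <- exp_plus; f_equal; ring).
    assert (E4 := exp_ineq1_le (p - q)); assert (E5 := exp_pos (- p)).
    rewrite Rabs_pos_eq, Rabs_left1 by lra.
    rewrite E3; nra. }
  intros p q Hp Hq; destruct (Rle_lt_dec p q) as [H | H]; [now apply W | ].
  rewrite Rabs_minus_sym, (Rabs_minus_sym p); apply W; lra. }
assert (Hlt : forall T u v, 1 <= T -> 1 / 2 <= u <= T -> 1 / 2 <= v <= T -> u < v ->
  Rabs (/ Euler_integral u - / Euler_integral v) <= exp (- B) * (M + 1) * T * Rabs (u - v)).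
{ intros T u v HT Hu Hv Huv.
  assert (A := Hlip u v ltac:(lra) Huv).
  assert (A' := Hexp (lnGamma u) (lnGamma v) (Hlow u ltac:(lra)) (Hlow v ltac:(lra))).
  unfold lnGamma in A' at 1 2.
  rewrite !exp_Ropp, !exp_ln, <- exp_Ropp in A' by (apply is_Euler_integral; lra).
  eapply Rle_trans; [exact A' | ].
  rewrite !Rmult_assoc; apply Rmult_le_compat_l; [left; apply exp_pos | ].
  eapply Rle_trans; [exact A | ].
  rewrite Rabs_left, <- Rmult_assoc by lra.
  replace (- (u - v)) with (v - u) by ring.
  apply Rmult_le_compat_r; nra. }
intros T u v HT Hu Hv; destruct (Rtotal_order u v) as [H | [-> | H]].
- now apply Hlt.
- unfold Rminus; rewrite !Rplus_opp_r, Rabs_R0; lra.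
- rewrite (Rabs_minus_sym u), Rabs_minus_sym; now apply Hlt.
Qed.

(** * Differentiation of series *)

Lemma Rabs_sum_lt_eventually {T : Type} (F : (T -> Prop) -> Prop) {FF : Filter F}
  (q : nat -> T -> R) :
  (forall k e, 0 < e -> F (fun h => Rabs (q k h) < e)) ->
  forall n e, 0 < e -> F (fun h => Rabs (sum_f_R0 (fun k => q k h) n) < e).
Proof.
intros H n; induction n as [ | n IH]; intros e He; simpl; [now apply H | ].
generalize (filter_and (F := F) _ _ (IH (e / 2) ltac:(lra)) (H (S n) (e / 2) ltac:(lra))).
apply filter_imp; intros h [H1 H2].
eapply Rle_lt_trans; [apply Rabs_triang | lra].
Qed.

Lemma ex_series_Rabs_le (a b : nat -> R) :
  (forall n, Rabs (a n) <= b n) -> ex_series b -> ex_series a.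
Proof. intros H Hb; now apply (@ex_series_le R_AbsRing R_CompleteNormedModule a b). Qed.

(** Tannery's theorem: a tail of the dominating series is small, and the finitely
    many terms before it become small along the filter. *)
Lemma Series_dominated_small {T : Type} (F : (T -> Prop) -> Prop) {FF : Filter F}
  (q : nat -> T -> R) (M : nat -> R) :
  (forall k e, 0 < e -> F (fun h => Rabs (q k h) < e)) ->
  F (fun h => forall k, Rabs (q k h) <= M k) -> ex_series M ->
  forall e, 0 < e -> F (fun h => Rabs (Series (fun k => q k h)) < e).
Proof.
intros Hq HM Hex e He.
assert (Htail : exists n, Series (fun k => M (S n + k)%nat) < e / 2).
{ destruct (proj2 (is_lim_seq_spec (sum_n M) (Series M)) (Series_correct M Hex) (mkposreal (e / 2) ltac:(lra)))
    as [n Hn].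
  exists n; specialize (Hn n (le_n n)); simpl in Hn.
  rewrite (Series_incr_n M (S n)), sum_n_Reals in Hn by (lia || assumption); simpl in Hn.
  apply Rabs_def2 in Hn; simpl; lra. }
destruct Htail as [n Hn].
generalize (filter_and (F := F) _ _ (Rabs_sum_lt_eventually F q Hq n (e / 2) ltac:(lra)) HM).
apply filter_imp; intros h [H1 H2].
assert (HexM : ex_series (fun k => M (S n + k)%nat)) by now apply (ex_series_incr_n M).
rewrite (Series_incr_n _ (S n)); [ | lia | now apply (ex_series_Rabs_le _ M)].
replace (pred (S n)) with n by reflexivity.
eapply Rle_lt_trans; [apply Rabs_triang | ].
assert (H3 : Rabs (Series (fun k => q (S n + k)%nat h)) <= Series (fun k => M (S n + k)%nat)).
{ eapply Rle_trans; [apply Series_Rabs | apply Series_le].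
  - apply (ex_series_Rabs_le _ (fun k => M (S n + k)%nat)); [ | exact HexM].
    intros k; rewrite Rabs_Rabsolu; apply H2.
  - intros k; split; [apply Rabs_pos | apply H2].
  - exact HexM. }
lra.
Qed.

Lemma Rabs_derive_le (f : R -> R) (a d m r : R) : 0 < r -> is_derive f a d ->
  (forall y, Rabs (y - a) < r -> Rabs (f y - f a) <= m * Rabs (y - a)) -> Rabs d <= m.
Proof.
intros Hr Hd Hm; apply is_derive_Reals in Hd.
apply Rnot_lt_le; intros Hlt.
destruct (Hd (Rabs d - m) ltac:(lra)) as [del Hdel].
set (h := Rmin del r / 2).
assert (Hh : 0 < h /\ h < del /\ h < r).
{ assert (A := Rmin_l del r); assert (B := Rmin_r del r).
  assert (0 < Rmin del r) by (apply Rmin_pos; [apply cond_pos | exact Hr]).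
  unfold h; repeat split; lra. }
assert (E : Rabs h = h) by (apply Rabs_right; lra).
specialize (Hdel h ltac:(lra) ltac:(lra)).
specialize (Hm (a + h)); replace (a + h - a) with h in Hm by ring.
specialize (Hm ltac:(lra)); rewrite E in Hm.
assert (H1 : Rabs ((f (a + h) - f a) / h) <= m).
{ unfold Rdiv; rewrite Rabs_mult, Rabs_inv, E; apply Rle_div_l; lra. }
rewrite Rabs_minus_sym in Hdel.
assert (H2 := Rabs_triang_inv d ((f (a + h) - f a) / h)); lra.
Qed.

(** Domination is required of the difference quotients at the single point [a];
    it then passes to the derivatives [d]. *)
Lemma is_derive_Series (f : nat -> R -> R) (d M : nat -> R) (a r : R) : 0 < r ->
  (forall k, is_derive (f k) a (d k)) ->
  (forall k y, Rabs (y - a) < r -> Rabs (f k y - f k a) <= M k * Rabs (y - a)) ->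
  ex_series M -> ex_series (fun k => f k a) ->
  is_derive (fun y => Series (fun k => f k y)) a (Series d).
Proof.
intros Hr Hd Hlip HM Hfa.
assert (HdM : forall k, Rabs (d k) <= M k).
{ intros k; apply (Rabs_derive_le (f k) a _ _ r); auto. }
assert (Hexd : ex_series d) by now apply (ex_series_Rabs_le _ M).
assert (Hexf : forall y, Rabs (y - a) < r -> ex_series (fun k => f k y)).
{ intros y Hy.
  apply (ex_series_ext (fun k => plus (f k y - f k a) (f k a))).
  - intros k; change (f k y - f k a + f k a = f k y); ring.
  - apply @ex_series_plus; [ | exact Hfa].
    apply (ex_series_Rabs_le _ (fun k => scal (Rabs (y - a)) (M k))).
    + intros k; unfold scal; simpl; unfold mult; simpl; rewrite Rmult_comm; now apply Hlip.
    + apply (ex_series_scal (V:=R_NormedModule)); exact HM. }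
apply is_derive_Reals; intros e He.
set (q := fun k h => (f k (a + h) - f k a) / h - d k).
assert (Hsmall : Rbar_locally' 0 (fun h => Rabs (Series (fun k => q k h)) < e)).
{ apply (Series_dominated_small (Rbar_locally' 0) q (fun k => scal 2 (M k))); [ | | | exact He].
  - intros k e' He'; specialize (Hd k); apply is_derive_Reals in Hd.
    destruct (Hd e' He') as [del Hdel]; exists del; intros h Hh Hh0.
    apply Hdel; [exact Hh0 | ].
    rewrite ball_Rabs in Hh; simpl in Hh.
    now rewrite Rminus_0_r in Hh.
  - exists (mkposreal r Hr); refine (fun (h : R) Hh Hh0 k => _).
    rewrite ball_Rabs in Hh; simpl in Hh.
    rewrite Rminus_0_r in Hh.
    unfold scal, q; simpl; unfold mult; simpl.
    unfold Rminus at 1; eapply Rle_trans; [apply Rabs_triang | rewrite Rabs_Ropp].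
    assert (Rabs ((f k (a + h) - f k a) / h) <= M k); [ | assert (A := HdM k); lra].
    unfold Rdiv; rewrite Rabs_mult, Rabs_inv; apply Rle_div_l; [now apply Rabs_pos_lt | ].
    assert (A := Hlip k (a + h)); replace (a + h - a) with h in A by ring; now apply A.
  - apply (ex_series_scal (V:=R_NormedModule)); exact HM. }
destruct Hsmall as [[del Hdel] H].
assert (Hm : 0 < Rmin del r) by now apply Rmin_pos.
exists (mkposreal _ Hm); intros h Hh0 Hh; simpl in Hh.
assert (A := Rmin_l del r); assert (B := Rmin_r del r).
replace ((Series (fun k => f k (a + h)) - Series (fun k => f k a)) / h - Series d)
  with (Series (fun k => q k h)).
- apply H; [ | exact Hh0].
  rewrite ball_Rabs.
  simpl; rewrite Rminus_0_r; lra.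
- assert (Hah : ex_series (fun k => f k (a + h))).
  { apply Hexf; replace (a + h - a) with h by ring; lra. }
  unfold q, Rdiv; rewrite Series_minus.
  + rewrite Series_scal_r, Series_minus by assumption; reflexivity.
  + apply ex_series_scal_r, @ex_series_minus; assumption.
  + exact Hexd.
Qed.

(** * The derivatives of the Wright and Bessel series *)

Lemma rGamma_pos (y : R) : 0 < y -> rGamma y = / Euler_integral y.
Proof.
intros Hy; unfold rGamma.
destruct (excluded_middle_informative (Gamma_pole y)) as [[m Hm] | _].
- assert (A := pos_INR m); lra.
- assert (E : Gamma_shift y = 0%nat).
  { unfold Gamma_shift; assert (A := archimed (- y)).
    assert (Hup : (up (- y) < 1)%Z) by (apply lt_IZR; simpl; lra).
    lia. }
  unfold Gamma; rewrite E; simpl; rewrite Rplus_0_r; f_equal; field.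
Qed.

Lemma rGamma_0 : rGamma 0 = 0.
Proof.
unfold rGamma.
destruct (excluded_middle_informative (Gamma_pole 0)) as [_ | H]; [reflexivity | ].
exfalso; apply H; exists 0%nat; simpl; ring.
Qed.

Lemma is_derive_rGamma (s : R) : 0 < s -> is_derive rGamma s (Derive rGamma s).
Proof.
intros Hs; apply Derive_correct.
apply (ex_derive_ext_loc (fun t => / Euler_integral t)); [ | now apply ex_derive_inv_Euler_integral].
exists (mkposreal s Hs); intros y Hy; symmetry; apply rGamma_pos.
rewrite ball_Rabs in Hy; simpl in Hy.
apply Rabs_def2 in Hy; lra.
Qed.

Lemma ex_series_exp_scal (y c : R) : ex_series (fun k => c * (y ^ k / INR (fact k))).
Proof.
apply (ex_series_scal (V := R_NormedModule) c (fun k => y ^ k / INR (fact k))); exists (exp y).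
apply (is_series_ext (fun k => scal (pow_n y k) (/ INR (fact k)))); [ | apply is_exp_Reals].
intros k; unfold scal; simpl; unfold mult; simpl; rewrite pow_n_pow; reflexivity.
Qed.

Lemma succ_le_pow_2 (k : nat) : INR k + 1 <= 2 ^ k.
Proof.
induction k as [ | k IH]; [simpl; lra | rewrite S_INR; simpl].
assert (A := pos_INR k); lra.
Qed.

(** The common form of the two series: [p k = k + 1] gives the Wright series in
    [alpha - 1], and [p k = 1] the series of [I_nu] in [nu]. Dividing by [p k]
    makes the derivative at [h = 0] independent of [p]. *)
Definition stretched_series (p : nat -> R) (x h : R) : R :=
  Series (fun k => x ^ k / INR (fact k) * (rGamma (INR k + 1 + p k * h) / p k)).

(** For [|h| < 1/2] the arguments [k + 1 + p k * h] stay in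
    [[(k + 1) / 2, 2 (k + 1)]], where the Lipschitz constant of [1 / Gamma] is
    linear in [k + 1], and the values of [1 / Gamma] at [k + 1] grow at most like
    [(k + 1)^2]; since [(k + 1)^2 <= 4^k], the exponential series of [4 |x|]
    dominates. *)
Lemma is_derive_stretched_series (p : nat -> R) (x : R) :
  (forall k, 1 <= p k <= INR k + 1) ->
  is_derive (stretched_series p x) 0
    (Series (fun k => x ^ k / INR (fact k) * Derive rGamma (INR k + 1))).
Proof.
intros Hp.
destruct inv_Euler_integral_lipschitz as [C [HC Hlip]].
assert (Hc : forall k, Rabs (x ^ k / INR (fact k)) = Rabs x ^ k / INR (fact k)).
{ intros k; unfold Rdiv; rewrite Rabs_mult, RPow_abs, Rabs_inv, (Rabs_right (INR _)); [reflexivity | ].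
  apply Rle_ge, pos_INR. }
assert (Hc0 : forall k, 0 <= Rabs x ^ k / INR (fact k)).
{ intros k; rewrite <- Hc; apply Rabs_pos. }
assert (Hpow : forall c k, 0 <= c ->
  Rabs x ^ k / INR (fact k) * (c * (INR k + 1) * (INR k + 1)) <= c * ((4 * Rabs x) ^ k / INR (fact k))).
{ intros c k Hc1.
  replace ((4 * Rabs x) ^ k) with (2 ^ k * 2 ^ k * Rabs x ^ k).
  - replace (c * (2 ^ k * 2 ^ k * Rabs x ^ k / INR (fact k)))
      with (Rabs x ^ k / INR (fact k) * (c * (2 ^ k * 2 ^ k))) by (unfold Rdiv; ring).
    apply Rmult_le_compat_l; [apply Hc0 | rewrite Rmult_assoc; apply Rmult_le_compat_l; [exact Hc1 | ]].
    assert (A := succ_le_pow_2 k); assert (B := pos_INR k); apply Rmult_le_compat; lra.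
  - rewrite <- !Rpow_mult_distr; f_equal; ring. }
unfold stretched_series.
(* The square of [k + 1] is one factor more than the Lipschitz bound gives, so
   that [Hpow] covers the domination here and the values at [0] below. *)
apply (is_derive_Series _ _ (fun k => Rabs x ^ k / INR (fact k) * (C * 2 * (INR k + 1) * (INR k + 1))) 0 (1 / 2)).
- lra.
- intros k; specialize (Hp k).
  apply (is_derive_ext (fun h => scal (x ^ k / INR (fact k) / p k) (rGamma (INR k + 1 + p k * h)))).
  { intros h; unfold scal; simpl; unfold mult; simpl; field; split; [lra | apply INR_fact_neq_0]. }
  replace (x ^ k / INR (fact k) * Derive rGamma (INR k + 1))
    with (scal (x ^ k / INR (fact k) / p k) (scal (p k) (Derive rGamma (INR k + 1)))).
  2: { unfold scal; simpl; unfold mult; simpl; field; split; [apply INR_fact_neq_0 | lra]. }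
  apply is_derive_scal.
  apply (is_derive_comp rGamma (fun h => INR k + 1 + p k * h)).
  + replace (INR k + 1 + p k * 0) with (INR k + 1) by ring.
    apply is_derive_rGamma; assert (A := pos_INR k); lra.
  + auto_derive; [exact I | ring].
- intros k y Hy; specialize (Hp k); rewrite Rminus_0_r in *.
  apply Rabs_def2 in Hy as Hy'.
  assert (A := pos_INR k).
  rewrite Rmult_0_r, Rplus_0_r, <- Rmult_minus_distr_l, Rabs_mult, Hc, Rmult_assoc.
  apply Rmult_le_compat_l; [apply Hc0 | ].
  rewrite !rGamma_pos by nra.
  replace (/ Euler_integral (INR k + 1 + p k * y) / p k - / Euler_integral (INR k + 1) / p k)
    with ((/ Euler_integral (INR k + 1 + p k * y) - / Euler_integral (INR k + 1)) / p k)
    by (unfold Rdiv; ring).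
  unfold Rdiv; rewrite Rabs_mult, (Rabs_inv (p k)), (Rabs_right (p k)) by lra.
  apply Rle_div_l; [lra | ].
  eapply Rle_trans; [apply (Hlip (2 * (INR k + 1))); nra | ].
  replace (INR k + 1 + p k * y - (INR k + 1)) with (p k * y) by ring.
  rewrite Rabs_mult, (Rabs_right (p k)) by lra.
  assert (B := Rabs_pos y).
  assert (B1 : 0 <= C * (INR k + 1)) by (apply Rmult_le_pos; lra).
  assert (B2 : 0 <= p k * Rabs y) by (apply Rmult_le_pos; lra).
  replace (C * (2 * (INR k + 1)) * (p k * Rabs y)) with (2 * (C * (INR k + 1)) * (p k * Rabs y)) by ring.
  replace (C * 2 * (INR k + 1) * (INR k + 1) * Rabs y * p k)
    with (2 * (C * (INR k + 1)) * (p k * Rabs y) * (INR k + 1)) by ring.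
  assert (B3 : 0 <= 2 * (C * (INR k + 1)) * (p k * Rabs y)) by (repeat apply Rmult_le_pos; lra).
  nra.
- apply (ex_series_Rabs_le _ (fun k => (C * 2) * ((4 * Rabs x) ^ k / INR (fact k)))).
  + intros k; assert (A := pos_INR k); rewrite Rabs_right; [apply Hpow; lra | ].
    apply Rle_ge, Rmult_le_pos; [apply Hc0 | ].
    repeat apply Rmult_le_pos; lra.
  + apply ex_series_exp_scal.
- set (G := Rabs (/ Euler_integral 1)).
  assert (HG : 0 <= G) by apply Rabs_pos.
  apply (ex_series_Rabs_le _ (fun k => (G + C) * ((4 * Rabs x) ^ k / INR (fact k)))).
  + intros k; specialize (Hp k); assert (A := pos_INR k).
    eapply Rle_trans; [ | apply Hpow; lra].
    rewrite Rmult_0_r, Rplus_0_r, Rabs_mult, Hc.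
    apply Rmult_le_compat_l; [apply Hc0 | ].
    rewrite rGamma_pos by lra.
    unfold Rdiv; rewrite Rabs_mult, (Rabs_inv (p k)), (Rabs_right (p k)) by lra.
    apply Rle_div_l; [lra | ].
    assert (B := Hlip (INR k + 1) (INR k + 1) 1 ltac:(lra) ltac:(lra) ltac:(lra)).
    assert (B' := Rabs_triang_inv (/ Euler_integral (INR k + 1)) (/ Euler_integral 1)); fold G in B'.
    replace (INR k + 1 - 1) with (INR k) in B by ring.
    rewrite (Rabs_right (INR k)) in B by lra.
    apply Rle_trans with ((G + C) * (INR k + 1) * (INR k + 1)); [ | ].
    * nra.
    * assert (0 <= (G + C) * (INR k + 1) * (INR k + 1)) by (repeat apply Rmult_le_pos; lra); nra.
  + apply ex_series_exp_scal.
Qed.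

Lemma is_derive_Wright (x : R) :
  is_derive (fun alpha => Wright alpha 0 x) 1
    (x * Series (fun k => x ^ k / INR (fact k) * Derive rGamma (INR k + 1))).
Proof.
set (p := fun k => INR k + 1).
apply (is_derive_ext (fun alpha => scal x (stretched_series p x (alpha - 1)))).
- intros alpha; unfold Wright, stretched_series, scal; simpl; unfold mult; simpl.
  rewrite (Series_incr_1_aux (fun k => x ^ k / INR (fact k) * rGamma (alpha * INR k + 0))).
  + rewrite <- Series_scal_l; apply Series_ext; intros k; unfold p.
    replace (alpha * INR (S k) + 0) with (INR k + 1 + (INR k + 1) * (alpha - 1))
      by (rewrite S_INR; ring).
    change (fact (S k)) with (S k * fact k)%nat; rewrite mult_INR, S_INR; simpl.
    field; split; [apply INR_fact_neq_0 | ].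
    assert (A := pos_INR k); lra.
  + simpl; rewrite Rmult_0_r, Rplus_0_r, rGamma_0; ring.
- apply is_derive_scal.
  rewrite <- (Rmult_1_l (Series _)).
  apply (is_derive_comp (stretched_series p x) (fun alpha => alpha - 1)).
  + rewrite Rminus_diag; apply is_derive_stretched_series.
    intros k; unfold p; assert (A := pos_INR k); lra.
  + auto_derive; [exact I | ring].
Qed.

(** * Principal branches at real arguments *)

Lemma Cexp_plus (a b : C) : Cexp (a + b) = (Cexp a * Cexp b)%C.
Proof.
destruct a as [a1 a2], b as [b1 b2]; unfold Cexp, Cmult, Cplus; simpl.
rewrite exp_plus, cos_plus, sin_plus; f_equal; ring.
Qed.

Lemma Cmod_Cexp (w : C) : Cmod (Cexp w) = exp (Re w).
Proof.
destruct w as [a b]; unfold Cexp, Cmod; simpl.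
assert (E := sin2_cos2 b); unfold Rsqr in E.
replace (exp a * cos b * (exp a * cos b * 1) + exp a * sin b * (exp a * sin b * 1))
  with (Rsqr (exp a)).
- apply sqrt_Rsqr; left; apply exp_pos.
- unfold Rsqr; replace (exp a * exp a) with (exp a * exp a * (sin b * sin b + cos b * cos b))
    by (rewrite E; ring); ring.
Qed.

(** In the closed upper half-plane [Carg] is a plain [acos], so the case [Im w = PI] is
    covered as well. *)
Lemma Clog_Cexp (w : C) : 0 <= Im w <= PI -> Clog (Cexp w) = w.
Proof.
intros Hw; unfold Clog, Carg; rewrite Cmod_Cexp, ln_exp.
destruct w as [a b]; simpl in *.
assert (Hp := exp_pos a).
destruct (Rle_dec 0 (exp a * sin b)) as [_ | H].
- replace (exp a * cos b / exp a) with (cos b) by (field; lra).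
  rewrite acos_cos by lra; reflexivity.
- exfalso; apply H, Rmult_le_pos; [lra | apply sin_ge_0; lra].
Qed.

Lemma Im_Clog_real (x : R) : 0 <= Im (Clog x) <= PI.
Proof.
unfold Clog, Carg; simpl.
destruct (Rle_dec 0 0); [apply acos_bound | lra].
Qed.

Lemma Cexp_Clog_real (x : R) : x <> 0 -> Cexp (Clog x) = RtoC x.
Proof.
intros Hx; unfold Clog, Carg; simpl.
destruct (Rle_dec 0 0) as [_ | H]; [ | lra].
rewrite Cmod_R.
assert (Hp : 0 < Rabs x) by now apply Rabs_pos_lt.
assert (E : Rsqr (x / Rabs x) = 1).
{ rewrite Rsqr_div', <- Rsqr_abs; field; now apply Rgt_not_eq, Rsqr_pos_lt. }
assert (Hb : -1 <= x / Rabs x <= 1).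
{ unfold Rsqr in E; split; nra. }
unfold Cexp, RtoC; simpl; rewrite exp_ln, cos_acos, sin_acos, E by assumption.
replace (1 - 1) with 0 by ring; rewrite sqrt_0; f_equal; [field; lra | ring].
Qed.

Definition half_log (x : R) : C := (Clog x / 2)%C.

Lemma half_log_components (x : R) :
  half_log x = (Re (Clog x) / 2, Im (Clog x) / 2).
Proof.
unfold half_log; destruct (Clog x) as [a b].
unfold Cdiv, Cinv, Cmult, RtoC; simpl; f_equal; field.
Qed.

Lemma Csqrt_real (x : R) : x <> 0 -> Csqrt x = Cexp (half_log x).
Proof.
intros Hx; unfold Csqrt; destruct (Ceq_dec x 0) as [H | _]; [ | reflexivity].
exfalso; apply Hx; now apply RtoC_inj.
Qed.

Lemma RtoC_2_neq_0 : RtoC 2 <> 0.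
Proof. intros H; apply RtoC_inj in H; lra. Qed.

(** Halving the argument [0] or [PI] of [x] keeps it in the principal range; this
    is why the logarithm of the square root has no extra [2 i PI]. *)
Lemma Clog_Csqrt_real (x : R) : x <> 0 -> Clog (Csqrt x) = half_log x.
Proof.
intros Hx; rewrite Csqrt_real by exact Hx; apply Clog_Cexp.
rewrite half_log_components; simpl; assert (H := Im_Clog_real x); simpl in H; lra.
Qed.

Lemma Csqrt_real_sqr (x : R) : x <> 0 -> (Csqrt x ^ 2)%C = x.
Proof.
intros Hx; rewrite Csqrt_real by exact Hx.
simpl; rewrite Cmult_1_r, <- Cexp_plus.
replace (half_log x + half_log x)%C with (Clog x).
- now apply Cexp_Clog_real.
- unfold half_log; field; apply RtoC_2_neq_0.
Qed.

(** * The Bessel functions at twice a square root *)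

Definition Bessel_sum (x nu : R) : R :=
  Series (fun k => x ^ k / INR (fact k) * rGamma (nu + INR k + 1)).

Lemma BesselI_real (x nu : R) : x <> 0 ->
  BesselI nu (2 * Csqrt x) = (Cexp (nu * half_log x) * Bessel_sum x nu)%C.
Proof.
intros Hx; unfold BesselI.
replace (2 * Csqrt x / 2)%C with (Csqrt x) by (field; apply RtoC_2_neq_0).
unfold Cpower; rewrite Clog_Csqrt_real by exact Hx; f_equal.
assert (E : forall k, (Csqrt x ^ (2 * k) / INR (fact k) * rGamma (nu + INR k + 1))%C =
  RtoC (x ^ k / INR (fact k) * rGamma (nu + INR k + 1))).
{ intros k; rewrite Cpow_mult_r, Csqrt_real_sqr by exact Hx.
  now rewrite RtoC_mult, RtoC_div, RtoC_pow by apply INR_fact_neq_0. }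
unfold CSeries; apply injective_projections; cbn [fst snd RtoC]; [unfold Bessel_sum | ].
- apply Series_ext; intros k; now rewrite E.
- rewrite <- (Rmult_0_l (Series (fun _ => 0))), <- Series_scal_l.
  apply Series_ext; intros k; rewrite E; simpl; ring.
Qed.

Lemma is_derive_Bessel_sum (x : R) :
  is_derive (Bessel_sum x) 0 (Series (fun k => x ^ k / INR (fact k) * Derive rGamma (INR k + 1))).
Proof.
apply (is_derive_ext (stretched_series (fun _ => 1) x)).
- intros nu; apply Series_ext; intros k; rewrite Rdiv_1_r.
  do 2 f_equal; ring.
- apply is_derive_stretched_series; intros k; assert (A := pos_INR k); lra.
Qed.

Lemma is_lim_difference_quotient (f : R -> R) (d : R) :
  is_derive f 0 d -> is_lim (fun h => (f h - f 0) / h) 0 d.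
Proof.
intros Hf; apply is_derive_Reals in Hf.
apply is_lim_spec; intros e; destruct (Hf e (cond_pos e)) as [del H].
exists del; intros h Hh Hh0; rewrite <- (Rplus_0_l h) at 1; apply H; [exact Hh0 | ].
rewrite ball_Rabs in Hh; simpl in Hh.
now rewrite Rminus_0_r in Hh.
Qed.

(** Numerator and denominator both vanish at [0], so the limit is the quotient
    of their derivatives, [- PI * d] and [PI]. *)
Lemma Lim_odd_part_over_sin (f : R -> R) (d : R) : is_derive f 0 d ->
  Lim (fun h => PI / 2 * (f (- h) - f h) / sin (h * PI)) 0 = - d.
Proof.
intros Hf; apply is_lim_unique.
assert (Hn : is_derive (fun h => PI / 2 * (f (- h) - f h)) 0 (- (PI * d))).
{ replace (- (PI * d)) with (scal (PI / 2) (minus (scal (-1) d) d))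
    by (unfold scal, minus, plus, opp; simpl; unfold mult; simpl; field).
  apply is_derive_scal, @is_derive_minus; [ | exact Hf].
  apply (is_derive_comp f Ropp).
  - rewrite Ropp_0; exact Hf.
  - auto_derive; [exact I | ring]. }
assert (Hs : is_derive (fun h => sin (h * PI)) 0 PI).
{ auto_derive; [exact I | rewrite Rmult_0_l, cos_0; ring]. }
apply is_lim_difference_quotient in Hn; apply is_lim_difference_quotient in Hs.
assert (HP := PI_RGT_0).
assert (H := is_lim_div _ _ 0 _ _ Hn Hs ltac:(intros E; injection E; lra)).
replace (Finite (- d)) with (Rbar_div (- (PI * d)) PI)
  by (simpl; f_equal; field; lra).
eapply is_lim_ext_loc; [ | apply H; simpl; lra].
exists (mkposreal 1 Rlt_0_1); intros h Hh Hh0; simpl.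
rewrite Ropp_0, Rmult_0_l, sin_0, !Rminus_0_r, Rminus_diag, Rmult_0_r, Rminus_0_r.
rewrite ball_Rabs in Hh; simpl in Hh.
rewrite Rminus_0_r in Hh; apply Rabs_def2 in Hh.
assert (Hsin : sin (h * PI) <> 0).
{ destruct (Rdichotomy h 0 Hh0) as [Hneg | Hpos].
  - apply Rlt_not_eq, sin_lt_0_var; nra.
  - apply Rgt_not_eq, sin_gt_0; nra. }
field; split; [exact Hsin | exact Hh0].
Qed.

(** [BesselK 0] is a componentwise limit; by [BesselI_real] the components of
    [I_nu] are [exp (nu a) cos (nu b) S(nu)] and [exp (nu a) sin (nu b) S(nu)],
    whose derivatives at [nu = 0] are [a S(0) + S'(0)] and [b S(0)]. *)
Lemma BesselK_0_real (x : R) : x <> 0 ->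
  BesselK 0 (2 * Csqrt x) =
    (- (half_log x * Bessel_sum x 0 + RtoC (Derive (Bessel_sum x) 0)))%C.
Proof.
intros Hx; unfold BesselK.
destruct (Req_EM_T (sin (0 * PI)) 0) as [_ | H]; [ | rewrite Rmult_0_l, sin_0 in H; lra].
unfold CLim, BesselK_quotient.
rewrite half_log_components.
set (a := Re (Clog x) / 2); set (b := Im (Clog x) / 2).
set (D := Derive (Bessel_sum x) 0).
assert (HD : is_derive (Bessel_sum x) 0 D).
{ apply Derive_correct; eexists; apply is_derive_Bessel_sum. }
set (re := fun h => exp (h * a) * cos (h * b) * Bessel_sum x h).
set (im := fun h => exp (h * a) * sin (h * b) * Bessel_sum x h).
assert (Hre : is_derive re 0 (a * Bessel_sum x 0 + D)).
{ replace (a * Bessel_sum x 0 + D) with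
    (plus (mult a (Bessel_sum x 0)) (mult (exp (0 * a) * cos (0 * b)) D)).
  - apply (is_derive_mult (fun h => exp (h * a) * cos (h * b)) (Bessel_sum x));
      [ | exact HD | intros; apply Rmult_comm].
    auto_derive; [exact I | rewrite !Rmult_0_l, exp_0, cos_0, sin_0; ring].
  - unfold plus, mult; simpl; rewrite !Rmult_0_l, exp_0, cos_0; ring. }
assert (Him : is_derive im 0 (b * Bessel_sum x 0)).
{ replace (b * Bessel_sum x 0) with
    (plus (mult b (Bessel_sum x 0)) (mult (exp (0 * a) * sin (0 * b)) D)).
  - apply (is_derive_mult (fun h => exp (h * a) * sin (h * b)) (Bessel_sum x));
      [ | exact HD | intros; apply Rmult_comm].
    auto_derive; [exact I | rewrite !Rmult_0_l, exp_0, cos_0, sin_0; ring].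
  - unfold plus, mult; simpl; rewrite !Rmult_0_l, exp_0, sin_0; ring. }
assert (EI : forall h, BesselI h (2 * Csqrt x) = (re h, im h)).
{ intros h; rewrite BesselI_real, half_log_components by exact Hx; fold a b.
  unfold Cexp, Cmult, RtoC, re, im; simpl; rewrite !Rmult_0_l, !Rmult_0_r, !Rminus_0_r, !Rplus_0_r, ?Rplus_0_l.
  reflexivity. }
assert (EQ : forall h, (RtoC (PI / 2) * (BesselI (- h) (2 * Csqrt x) - BesselI h (2 * Csqrt x))
    / RtoC (sin (h * PI)))%C =
  (PI / 2 * (re (- h) - re h) / sin (h * PI), PI / 2 * (im (- h) - im h) / sin (h * PI))).
{ intros h; rewrite !EI; unfold Cdiv.
  destruct (Req_EM_T (sin (h * PI)) 0) as [E | E].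
  (* both divisions by zero return zero *)
  - rewrite E; unfold Cinv, Cminus, Cplus, Copp, Cmult, RtoC, Rdiv; simpl.
    rewrite !Rmult_0_l, !Rplus_0_r, Rinv_0, Ropp_0, !Rmult_0_l, !Rmult_0_r. f_equal; ring.
  - unfold Cinv, Cminus, Cplus, Copp, Cmult, RtoC, Rdiv; simpl; f_equal; field; exact E. }
apply injective_projections; cbn [fst snd].
- rewrite (Lim_ext (fun h => PI / 2 * (re (- h) - re h) / sin (h * PI))) by (intros h; symmetry; now rewrite EQ).
  rewrite (Lim_odd_part_over_sin re _ Hre); simpl; ring.
- rewrite (Lim_ext (fun h => PI / 2 * (im (- h) - im h) / sin (h * PI))) by (intros h; symmetry; now rewrite EQ).
  rewrite (Lim_odd_part_over_sin im _ Him); simpl; ring.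
Qed.

Theorem theorem6p4 (x : R) (hx : x <> 0) :
  ex_derive (fun alpha : R => Wright alpha 0 x) 1 /\
  RtoC (Derive (fun alpha : R => Wright alpha 0 x) 1) =
    (- RtoC x *
       (BesselK 0 (2 * Csqrt (RtoC x)) +
        / 2 * BesselI 0 (2 * Csqrt (RtoC x)) * Clog (RtoC x)))%C.
Proof.
split; [eexists; apply is_derive_Wright | ].
rewrite (is_derive_unique (fun alpha : R => Wright alpha 0 x) 1 _ (is_derive_Wright x)).
rewrite BesselK_0_real, BesselI_real by exact hx.
rewrite (is_derive_unique _ _ _ (is_derive_Bessel_sum x)).
replace (Cexp (0 * half_log x)) with (RtoC 1).
- rewrite RtoC_mult; unfold half_log; field; apply RtoC_2_neq_0.
- rewrite Cmult_0_l; unfold Cexp, RtoC; simpl.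
  rewrite exp_0, cos_0, sin_0; f_equal; ring.
Qed.
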